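(* Let $t\ge 3$ and let $m_1\le m_2\le\cdots\le m_t$ be positive integers. Put $\Sigma=\sum_{i=1}^{t}(m_i-1)$ and $x=\left\lfloor\frac{\Sigma+t-1}{t-1}\right\rfloor$, and write $\Sigma=q(t-1)+h$ with integers $q,h$ and $0\le h\le t-2$. Assume $m_t\le R_{t-1}-1$, where $R_{t-1}=r_{t-2}^{t-1}(K_{1,m_1},\ldots,K_{1,m_{t-1}})$. Then $$r_{t-1}^{t}(K_{1,m_1},\ldots,K_{1,m_t})=\begin{cases} x & \text{if } x \text{ is odd, } h=0 \text{ and some } m_i \ (1\le i\le t) \text{ is even},\\ x+1 & \text{otherwise.}\end{cases}$$
   Context: All graphs are finite and simple. $K_p$ is the complete graph on $p$ vertices and $K_{1,m}$ is the star with $m$ edges (order $m+1$). For $k\ge 2$ and graphs $G_1,\ldots,G_k$, the $(k-1)$-chromatic Ramsey number $r_{k-1}^{k}(G_1,\ldots,G_k)$ is the least $p$ such that for every coloring of the edges of $K_p$ with $k$ colors $1,\ldots,k$ there is some $i\in\{1,\ldots,k\}$ such that the subgraph formed by the edges whose color lies in $\{1,\ldots,k\}\setminus\{i\}$ contains a copy of $G_i$. (Colorings are arbitrary, not necessarily proper, and not all colors need be used.) *)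

(* Defs.v *)
From mathcomp Require Import all_boot.

Set Implicit Arguments.
Unset Strict Implicit.
Unset Printing Implicit Defensive.

Record sgraph := SGraph {
  vertex :> finType;
  adj : rel vertex;
  adj_sym : symmetric adj;
  adj_irr : irreflexive adj }.

Definition complete_adj p : rel 'I_p := fun u v => u != v.

Lemma complete_sym p : symmetric (@complete_adj p).
Proof. by move=> u v; rewrite /complete_adj eq_sym. Qed.

Lemma complete_irr p : irreflexive (@complete_adj p).
Proof. by move=> u; rewrite /complete_adj eqxx. Qed.

Definition complete p : sgraph := SGraph (@complete_sym p) (@complete_irr p).

(* The star with m edges; its centre is [ord0]. *)
Definition star_adj m : rel 'I_m.+1 :=
  fun u v => (u != v) && ((u == ord0) || (v == ord0)).

Lemma star_sym m : symmetric (@star_adj m).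
Proof. by move=> u v; rewrite /star_adj eq_sym orbC. Qed.

Lemma star_irr m : irreflexive (@star_adj m).
Proof. by move=> u; rewrite /star_adj eqxx. Qed.

Definition star m : sgraph := SGraph (@star_sym m) (@star_irr m).

(* H contains a copy of G as a subgraph, not necessarily induced. *)
Definition contains_copy (H G : sgraph) : Prop :=
  exists f : G -> H, injective f /\ forall u v, adj u v -> adj (f u) (f v).

(* An edge coloring is given by a total function c on sets of vertices, of
   which only the values at the edges [set u; v] are ever used. *)
Definition colored_adj (G : sgraph) k (c : {set G} -> 'I_k) (A : {set 'I_k}) :
    rel G :=
  fun u v => adj u v && (c [set u; v] \in A).

Lemma colored_sym (G : sgraph) k (c : {set G} -> 'I_k) A :
  symmetric (colored_adj c A).
Proof. by move=> u v; rewrite /colored_adj adj_sym setUC. Qed.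

Lemma colored_irr (G : sgraph) k (c : {set G} -> 'I_k) A :
  irreflexive (colored_adj c A).
Proof. by move=> u; rewrite /colored_adj adj_irr. Qed.

(* The spanning subgraph formed by the edges whose color lies in A. *)
Definition colored_subgraph (G : sgraph) k (c : {set G} -> 'I_k) A : sgraph :=
  SGraph (@colored_sym G k c A) (@colored_irr G k c A).

Definition ramsey_property k (G : 'I_k -> sgraph) (p : nat) : Prop :=
  forall c : {set complete p} -> 'I_k,
    exists i : 'I_k, contains_copy (colored_subgraph c [set~ i]) (G i).

(* p is the (k-1)-chromatic Ramsey number r_{k-1}^k(G_1, ..., G_k); the color
   i.+1 (1 <= i.+1 <= k) is represented by i : 'I_k. Meant for k >= 2. *)
Definition is_chromatic_ramsey k (G : 'I_k -> sgraph) (p : nat) : Prop :=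
  ramsey_property G p /\ forall p', ramsey_property G p' -> p <= p'.

(* Main.v *)
Require Import Defs.
From mathcomp Require Import all_boot.
From mathcomp Require Import zify.

Set Implicit Arguments.
Unset Strict Implicit.
Unset Printing Implicit Defensive.

(** No star K_{1,m} with centre w avoids the color i in K_p exactly when at least
    p - m of the p - 1 edges at w have color i.  So K_p has a
    coloring without the forbidden stars iff its edges can be distributed so
    that every vertex has degree at least d_i = p - m_i in color i, for all i.

    Summing over the colors gives the necessary condition sum_i d_i <= p - 1,
    which fails at p = x + 1 ([ramsey_star_of_sum]).  At p = x it holds with
    slack exactly h.  If h = 0, every color class must be d_i-regular, and when
    x is odd and m_i is even this asks for a regular graph of odd degree on an
    odd number of vertices, contradicting the handshake lemma
    ([ramsey_star_of_parity]); in that case x is the answer, because the even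
    number x - 1 again satisfies the degree condition.

    In all other cases K_x has the required coloring.  The idea is to color K_p
    with many colors so that every vertex sees every color at least e times
    (a palette), and then to merge d_i / e of these colors into color i:
    - p even: a 1-factorization has p - 1 colors, with e = 1;
    - p odd, h > 0: there are p - 2 colors with e = 1 ([palette_odd]); the one
      color lost with respect to the number of edges is paid for by the slack;
    - p odd, h = 0, all m_i odd: the d_i are even, and a 2-factorization has
      (p - 1) / 2 colors, with e = 2.

    The hypothesis on m_t gives m_i <= x for all i, so that the d_i are
    nonnegative and really add up to x - 1 - h: K_{R-1} has a good coloring with t - 1
    colors, and counting there bounds (t - 2) m_t by m_1 + ... + m_{t-1}. *)

(** * Stars and color degrees *)

Lemma contains_starP (H : sgraph) m :
  contains_copy H (star m) <-> exists w : H, m <= #|[set v | adj w v]|.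
Proof.
split=> [[f [inj_f fE]] | [w le_m]].
  exists (f ord0); rewrite -[m in m <= _]card_ord.
  have inj_g : injective (fun j : 'I_m => f (lift ord0 j)).
    by move=> j j' /inj_f/lift_inj.
  rewrite -(card_imset _ inj_g); apply/subset_leq_card/subsetP=> v.
  by case/imsetP=> j _ ->; rewrite inE; apply: fE.
set A := [set v | adj w v] in le_m *.
have A_w (j : 'I_#|A|) : adj w (enum_val j) by move: (enum_valP j); rewrite inE.
pose leaf (j : 'I_m) : H := enum_val (widen_ord le_m j).
pose f (j : star m) : H := if unlift ord0 j is Some j' then leaf j' else w.
have f0 : f ord0 = w by rewrite /f unlift_none.
have fS j : f (lift ord0 j) = leaf j by rewrite /f liftK.
have neq_leaf j : leaf j <> w by move=> E; move: (A_w (widen_ord le_m j)); rewrite -/(leaf j) E adj_irr.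
exists f; split=> [u v | u v].
  case: (unliftP ord0 u) => [u' ->|->]; case: (unliftP ord0 v) => [v' ->|->]; rewrite ?f0 ?fS //.
  - by move/enum_val_inj=> /(congr1 val) /= E; congr (lift _ _); apply: val_inj.
  - by move/neq_leaf.
  - by move/esym/neq_leaf.
case: (unliftP ord0 u) => [u' ->|->]; case: (unliftP ord0 v) => [v' ->|->];
  rewrite ?f0 ?fS /= /star_adj ?eqxx //.
- by rewrite !(eq_sym _ ord0) !(negbTE (neq_lift _ _)) andbF.
- by move=> _; rewrite adj_sym A_w.
- by move=> _; apply: A_w.
Qed.

Definition color_degree p k (c : {set complete p} -> 'I_k) i (w : 'I_p) :=
  #|[set v : 'I_p | (v != w) && (c [set w; v] == i)]|.

(** The other p - 1 vertices split according to whether their edge to w has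
    color i. *)
Lemma card_colored_adjC p k (c : {set complete p} -> 'I_k) i (w : complete p) :
  #|[set v | @adj (colored_subgraph c [set~ i]) w v]| + color_degree c i w = p.-1.
Proof.
have -> : p.-1 = #|predC1 (w : 'I_p)| by rewrite cardC1 card_ord.
rewrite /color_degree.
rewrite -(cardID [pred v | c [set w; v] == i] (predC1 w)) addnC.
congr (_ + _); apply: eq_card => v; rewrite !inE //=.
by rewrite /colored_adj /= /complete_adj !inE eq_sym andbC.
Qed.

Lemma star_copyP p k (c : {set complete p} -> 'I_k) i m :
  contains_copy (colored_subgraph c [set~ i]) (star m) <->
  exists w : 'I_p, m + color_degree c i w < p.
Proof.
split=> [/contains_starP[w le_m] | [w lt_p]].
  by exists w; have := card_colored_adjC c i w; have := ltn_ord w; lia.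
by apply/contains_starP; exists w; have := card_colored_adjC c i w; lia.
Qed.

(** Every coloring is examined on its own, by a finite search over i and w, so
    that the argument by contradiction is constructive. *)
Lemma ramsey_star_of_no_coloring k (m : 'I_k -> nat) p :
  (forall c : {set complete p} -> 'I_k,
     (forall i w, p <= m i + color_degree c i w) -> False) ->
  ramsey_property (fun i => star (m i)) p.
Proof.
move=> no_c c.
have [/existsP[i /existsP[w lt_p]] | none] :=
    boolP [exists i, exists w, m i + color_degree c i w < p].
  by exists i; apply/star_copyP; exists w.
case: (no_c c) => i w; rewrite leqNgt; apply: contra none => lt_p.
by apply/existsP; exists i; apply/existsP; exists w.
Qed.

(** A coloring of the larger complete graph restricts to the smaller one. *)
Lemma ramsey_property_mono k (G : 'I_k -> sgraph) p p' :
  p <= p' -> ramsey_property G p -> ramsey_property G p'.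
Proof.
move=> le_pp' Gp c; pose g : 'I_p -> 'I_p' := widen_ord le_pp'.
have inj_g : injective g by move=> u v /(congr1 val) /= /val_inj.
have [i [f [inj_f fE]]] := Gp (fun S => c (g @: S)).
exists i, (fun u => g (f u)); split=> [u v /inj_g/inj_f // | u v /fE].
by rewrite /= /colored_adj /= /complete_adj (inj_eq inj_g) imsetU1 imset_set1.
Qed.

Lemma ramsey_star_gt k (m : 'I_k -> nat) p (c : {set complete p} -> 'I_k) p' :
  (forall i w, p <= m i + color_degree c i w) ->
  ramsey_property (fun i => star (m i)) p' -> p < p'.
Proof.
move=> good Rp'; rewrite ltnNge; apply/negP=> le_p'p.
have [i /star_copyP[w]] := ramsey_property_mono le_p'p Rp' c.
by rewrite ltnNge good.
Qed.

(** * Upper bounds: counting and parity *)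

Lemma sum_color_degree p k (c : {set complete p} -> 'I_k) w :
  \sum_i color_degree c i w = p.-1.
Proof.
have -> : p.-1 = #|predC1 w| by rewrite cardC1 card_ord.
rewrite -sum1_card.
rewrite (partition_big (fun v => c [set w; v]) xpredT) //=.
by apply: eq_bigr => i _; rewrite /color_degree -sum1dep_card.
Qed.

(** In a coloring without the forbidden stars, the k inequalities
    p <= m_i + deg_i(w) at a single vertex w add up to
    k p <= sum_i m_i + p - 1. *)
Lemma ramsey_star_of_sum k (m : 'I_k -> nat) p :
  0 < p -> \sum_i m i + p <= k * p -> ramsey_property (fun i => star (m i)) p.
Proof.
move=> p_gt0 le_m; apply: ramsey_star_of_no_coloring => c good.
pose w := Ordinal p_gt0.
have: \sum_(i < k) p <= \sum_i (m i + color_degree c i w) by apply: leq_sum.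
by move: le_m; rewrite big_split /= sum_color_degree sum_nat_const card_ord; lia.
Qed.

(** The ordered pairs (w, v) with v < w and those with w < v correspond to each
    other by symmetry. *)
Lemma handshake p (e : rel 'I_p) :
  symmetric e -> irreflexive e -> ~~ odd (\sum_w #|[set v | e w v]|).
Proof.
move=> sym_e irr_e; pose lower := \sum_(w < p) \sum_(v < p | e w v && (v < w)) 1.
suff -> : \sum_w #|[set v | e w v]| = lower + lower by rewrite addnn odd_double.
have {2}-> : lower = \sum_(w < p) \sum_(v < p | e w v && ~~ (v < w)) 1.
  rewrite /lower (exchange_big_dep xpredT) //=; apply: eq_bigr => w _.
  apply: eq_bigl => v; rewrite sym_e; case e_wv: (e w v) => //=.
  have: v != w by apply: contraTneq e_wv => ->; rewrite irr_e.
  by rewrite -(inj_eq val_inj) /=; lia.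
rewrite -big_split /=; apply: eq_bigr => w _.
by rewrite -sum1dep_card (bigID (fun v : 'I_p => v < w)).
Qed.

(** The value of sum_i m_i is the one at which the counting bound just fails to
    apply: every inequality p <= m_i + deg_i(w) is then an equality, so color i0
    would form a regular graph of odd degree p - m_i0 on p vertices, p odd. *)
Lemma ramsey_star_of_parity k (m : 'I_k -> nat) p i0 :
  odd p -> \sum_i m i + p = (k * p).+1 -> ~~ odd (m i0) ->
  ramsey_property (fun i => star (m i)) p.
Proof.
move=> odd_p sum_m even_m; apply: ramsey_star_of_no_coloring => c good.
have deg w : m i0 + color_degree c i0 w = p.
  have rest : \sum_(i < k | i != i0) p
                <= \sum_(i < k | i != i0) (m i + color_degree c i w).
    by apply: leq_sum.
  have total : \sum_i (m i + color_degree c i w) = \sum_(i < k) p.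
    by move: sum_m; rewrite big_split /= sum_color_degree sum_nat_const card_ord; lia.
  move: total (good i0 w) rest; rewrite (bigD1 i0) //= [RHS](bigD1 i0) //=.
  set A := \sum_(i < k | _) p; set B := \sum_(i < k | _) _; lia.
pose e : rel 'I_p := fun w v => (v != w) && (c [set w; v] == i0).
have sym_e : symmetric e by move=> u v; rewrite /e eq_sym setUC.
have irr_e : irreflexive e by move=> u; rewrite /e eqxx.
have p_gt0 : 0 < p by case: (p) odd_p.
have le_mp : m i0 <= p by rewrite -(deg (Ordinal p_gt0)) leq_addr.
apply: (negP (handshake sym_e irr_e)); rewrite (eq_bigr (fun=> p - m i0)).
  by rewrite sum_nat_const card_ord oddM odd_p oddB // odd_p (negbTE even_m).
by move=> w _; rewrite -[LHS]/(color_degree c i0 w) -[in RHS](deg w) addKn.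
Qed.

(** * Palettes *)

(** Passes from a symmetric function of two vertices to a function of the edge,
    by picking an arbitrary ordering of its endpoints. *)
Lemma set_coloring (T : finType) (U : Type) (f : T -> T -> U) (u0 : U) :
  (forall u v, f u v = f v u) ->
  exists c : {set T} -> U, forall u v, c [set u; v] = f u v.
Proof.
move=> sym_f.
exists (fun S => if [pick e | S == [set e.1; e.2]] is Some e then f e.1 e.2 else u0).
move=> u v; case: pickP => [[a b] /= /eqP E | /(_ (u, v))]; last by rewrite eqxx.
have: (a \in [set u; v]) && (b \in [set u; v]) by rewrite E !inE !eqxx orbT.
have: (u \in [set a; b]) && (v \in [set a; b]) by rewrite -E !inE !eqxx orbT.
rewrite !inE.
by case/andP=> /orP[]/eqP-> /orP[]/eqP-> /andP[/orP[]/eqP ? /orP[]/eqP ?]; subst.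
Qed.

(** Only the colors s < n are guaranteed at each vertex; f may take other values,
    which keeps arithmetic definitions of f free of range conditions. *)
Definition palette p n e (f : nat -> nat -> nat) :=
  (forall u v, f u v = f v u) /\
  forall (w : 'I_p) s, s < n -> e <= #|[set v : 'I_p | (v != w) && (f w v == s)]|.

(** List a_i copies of each i, one after the other, and read g off this list. *)
Lemma class_sizes k (a : 'I_k -> nat) n :
  0 < k -> \sum_i a i <= n ->
  exists g : nat -> 'I_k, forall i, a i <= \sum_(s < n | g s == i) 1.
Proof.
case: k a => // k a _ le_n.
pose l := flatten [seq nseq (a i) i | i <- enum 'I_k.+1].
have size_l : size l = \sum_i a i.
  rewrite size_flatten /shape -map_comp sumnE big_map big_enum /=.
  by apply: eq_bigr => i _; rewrite size_nseq.
exists (nth ord0 l) => i.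
have <- : count_mem i l = a i.
  rewrite count_flatten -map_comp sumnE big_map big_enum /=.
  rewrite (bigD1 i) //= big1 => [|j /negbTE ne_ji]; first by rewrite count_nseq /= eqxx; lia.
  by rewrite count_nseq /= ne_ji.
rewrite -sum1_count -[l in X in X <= _](mkseq_nth ord0) big_map.
rewrite -(big_mkord (fun s => nth ord0 l s == i) (fun=> 1)).
have le_l : size l <= n by rewrite size_l.
by rewrite (big_cat_nat _ le_l) //= {1}/index_iota subn0 leq_addr.
Qed.

(** If the palette colors are grouped by g, with at least a_i of them in group i,
    a vertex meets each color of the group e times, on pairwise distinct
    edges. *)
Lemma merge_palette p n e f k (a : 'I_k -> nat) :
  palette p n e f -> 0 < k -> \sum_i a i <= n ->
  exists c : {set complete p} -> 'I_k, forall i w, e * a i <= color_degree c i w.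
Proof.
case=> sym_f pal k_gt0 /(class_sizes k_gt0)[g gP].
have [c cE] := @set_coloring 'I_p _ (fun u v => g (f u v)) (g 0)
                 (fun u v => congr1 g (sym_f u v)).
exists c => i w.
have -> : color_degree c i w = \sum_(v < p | (v != w) && (g (f w v) == i)) 1.
  by rewrite sum1dep_card; apply: eq_card => v; rewrite !inE cE.
apply: (@leq_trans (\sum_(s < n | g s == i) \sum_(v < p | (v != w) && (f w v == s)) 1)).
  apply: (@leq_trans (\sum_(s < n | g s == i) e)).
    by rewrite sum_nat_cond_const mulnC leq_mul2r -sum1dep_card gP orbT.
  by apply: leq_sum => s _; rewrite sum1dep_card pal.
rewrite (exchange_big_dep (fun v : 'I_p => (v != w) && (g (f w v) == i))) /=; last first.
  by move=> s v gs /andP[-> /eqP->].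
apply: leq_sum => v _; rewrite sum1dep_card.
apply/card_le1_eqP => s s'; rewrite !inE => /and3P[_ _ /eqP fs] /and3P[_ _ /eqP fs'].
by apply: val_inj; rewrite /= -fs.
Qed.

Lemma palette1 p n f : (forall u v, f u v = f v u) ->
  (forall w s, w < p -> s < n -> exists v, [/\ v < p, v <> w & f w v = s]) ->
  palette p n 1 f.
Proof.
move=> sym_f fP; split=> // w s lt_sn.
have [v [lt_v /eqP ne_vw fs]] := fP w s (ltn_ord w) lt_sn.
by apply/card_gt0P; exists (Ordinal lt_v); rewrite !inE -(inj_eq val_inj) /= ne_vw fs eqxx.
Qed.

(** The round-robin 1-factorization: the vertices are the residues modulo the odd
    number n = p - 1 and a point at infinity, encoded as n.  The edge uv has
    color u + v modulo n, and the edge from u to infinity takes the color 2u that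
    u misses among the residues. *)
Lemma palette_even p : ~~ odd p -> 0 < p -> exists f, palette p p.-1 1 f.
Proof.
move=> even_p p_gt0; pose n := p.-1; pose red s := if s < n then s else s - n.
exists (fun u v => if u == n then red (v + v) else if v == n then red (u + u) else red (u + v)).
apply: palette1 => [u v | w s lt_w lt_s].
  by rewrite /red; repeat case: ifP => //; lia.
(* At infinity, color s is on the edge to s / 2 modulo n. *)
pose v := if w == n then (if odd s then s + n else s)./2
          else let r := if w <= s then s - w else s + n - w in if r == w then n else r.
exists v; rewrite /v /red /n; split; repeat case: ifP => //; lia.
Qed.

(** Color uv by u + v modulo p: the class of sum r is a matching that misses only
    the vertex w with 2w = r.  The classes of sum 0 and 1 are broken up to repair
    the others.  A vertex w with 1 <= w <= (p - 1)/2 receives the edge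
    {w, -w} of the class 0, and a vertex w >= (p + 3)/2 the edge {w, 1 - w} of
    the class 1; these edges are distinct, and each is recolored with the color
    2w that w misses.  The two vertices left over, 0 and (p + 1)/2, are those
    missed by the classes 0 and 1 themselves.  Colors are shifted by 2, so that
    the remaining sums 2, ..., p - 1 become 0, ..., p - 3. *)
Lemma palette_odd p : odd p -> exists f, palette p (p - 2) 1 f.
Proof.
move=> odd_p.
exists (fun u v => if u + v == p then (minn u v).*2 - 2
   else if u + v == p.+1 then (maxn u v).*2 - p - 2
   else if u + v < p then u + v - 2 else u + v - p - 2).
apply: palette1 => [u v | w s lt_w lt_s].
  by rewrite addnC minnC maxnC.
(* v is the vertex with v + w = r modulo p; if it is w itself, then w is the
   vertex missed by the class r, and the edge given to w is used. *)
pose r := s.+2; pose v := if w <= r then r - w else r + p - w.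
exists (if v != w then v else if w.*2 == r then p - w else p.+1 - w).
rewrite /v /r; split; repeat case: ifP => //; lia.
Qed.

(** The 2-factorization by cyclic distance: at each vertex w, the distance s + 1
    is realized by w + (s + 1) and by w - (s + 1), which differ as p is odd. *)
Lemma palette_odd2 p : odd p -> exists f, palette p p./2 2 f.
Proof.
move=> odd_p; pose d u v := (u - v) + (v - u).
exists (fun u v => (minn (d u v) (p - d u v)).-1); split=> [u v | w s lt_s].
  by rewrite /d addnC.
have lt_w := ltn_ord w.
have lt1 : (if w + s.+1 < p then w + s.+1 else w + s.+1 - p) < p by case: ifP; lia.
have lt2 : (if s.+1 <= w then w - s.+1 else w + p - s.+1) < p by case: ifP; lia.
apply/card_gt1P; exists (Ordinal lt1), (Ordinal lt2).
rewrite !inE -!(inj_eq val_inj) /= /d; split; repeat case: ifP => //; lia.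
Qed.

(** * Colorings without the forbidden stars *)

Lemma coloring_even k (m : 'I_k -> nat) p :
  ~~ odd p -> 0 < p -> 0 < k -> \sum_i (p - m i) <= p.-1 ->
  exists c : {set complete p} -> 'I_k, forall i w, p <= m i + color_degree c i w.
Proof.
move=> even_p p_gt0 k_gt0 le_sum; have [f pal] := palette_even even_p p_gt0.
have [c cP] := merge_palette pal k_gt0 le_sum.
by exists c => i w; have := cP i w; rewrite mul1n leq_subLR.
Qed.

Lemma coloring_odd k (m : 'I_k -> nat) p :
  odd p -> 0 < k -> \sum_i (p - m i) <= p - 2 ->
  exists c : {set complete p} -> 'I_k, forall i w, p <= m i + color_degree c i w.
Proof.
move=> odd_p k_gt0 le_sum; have [f pal] := palette_odd odd_p.
have [c cP] := merge_palette pal k_gt0 le_sum.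
by exists c => i w; have := cP i w; rewrite mul1n leq_subLR.
Qed.

(** All p - m_i are even (or truncated to 0), so that halving loses nothing and the
    2-factorization attains the bound p - 1 of the even case. *)
Lemma coloring_odd_odd k (m : 'I_k -> nat) p :
  odd p -> 0 < k -> (forall i, odd (m i)) -> \sum_i (p - m i) <= p.-1 ->
  exists c : {set complete p} -> 'I_k, forall i w, p <= m i + color_degree c i w.
Proof.
move=> odd_p k_gt0 odd_m le_sum; have [f pal] := palette_odd2 odd_p.
have half i : 2 * (p - m i)./2 = p - m i by have := odd_m i; lia.
have le_half : \sum_i (p - m i)./2 <= p./2.
  rewrite -(leq_pmul2l (isT : 0 < 2)) big_distrr /= (eq_bigr _ (fun i _ => half i)).
  by apply: leq_trans le_sum _; lia.
have [c cP] := merge_palette pal k_gt0 le_half.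
by exists c => i w; have := cP i w; rewrite half leq_subLR.
Qed.

(** * The Ramsey number *)

(** The statement in terms of the slack: at p = x the degrees x - m_i required at
    each vertex add up to x - 1 - h, by the hypothesis on the sum.  The condition
    h < k - 1 makes the counting bound apply at x + 1. *)
Lemma star_ramsey_number k (m : 'I_k -> nat) x h :
  (forall i, m i <= x) -> \sum_i m i = k.-1 * x + h.+1 -> h < k.-1 ->
  is_chromatic_ramsey (fun i => star (m i))
    (if [&& odd x, h == 0 & [exists i, ~~ odd (m i)]] then x else x + 1).
Proof.
move=> le_mx sum_m lt_hk; have k_gt0 : 0 < k by lia.
have kM y : k * y = k.-1 * y + y by rewrite -{1}(prednK k_gt0) mulSn addnC.
have sum_d : \sum_i (x - m i) + h.+1 = x.
  have: \sum_i (x - m i) + \sum_i m i = k * x.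
    rewrite -big_split /= (eq_bigr (fun=> x)) => [|i _]; last by rewrite subnK.
    by rewrite sum_nat_const card_ord.
  by move: (\sum_i (x - m i)) => d; rewrite sum_m kM; lia.
have upper : ramsey_property (fun i => star (m i)) x.+1.
  by apply: ramsey_star_of_sum => //; rewrite sum_m kM mulnS; lia.
case: ifP => [/and3P[odd_x /eqP h0 /existsP[i0 even_m]] | not_exc].
  split=> [|p'].
    by apply: (ramsey_star_of_parity odd_x _ even_m); rewrite sum_m kM h0; lia.
  (* K_{x-1} has even, positive order.  Since x - m_i0 > 0, passing from x to x - 1
     lowers the total x - 1 of the required degrees to at most x - 2. *)
  have m_i0 : 0 < m i0 < x.
    apply/andP; split; last by have := le_mx i0; lia.
    have: x - m i0 <= \sum_i (x - m i) by rewrite (bigD1 i0) //= leq_addr.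
    by move: (\sum_i (x - m i)) sum_d => d; lia.
  have le_sum : \sum_i (x.-1 - m i) <= x.-1.-1.
    have rest : \sum_(i | i != i0) (x.-1 - m i) <= \sum_(i | i != i0) (x - m i).
      by apply: leq_sum => i _; rewrite leq_sub2r ?leq_pred.
    move: sum_d rest; rewrite (bigD1 i0) //= [in X in _ -> _ -> X](bigD1 i0) //=.
    by set A := \sum_(i < k | _) (x - m i); set B := \sum_(i < k | _) _; lia.
  have [||c /ramsey_star_gt gt_p /gt_p] := coloring_even _ _ k_gt0 le_sum; lia.
rewrite addn1; split=> // p'.
suff [c /ramsey_star_gt gt_p /gt_p] : exists c : {set complete x} -> 'I_k,
  forall i w, x <= m i + color_degree c i w by [].
have [odd_x | even_x] := boolP (odd x); last by apply: coloring_even => //; lia.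
case: (posnP h) => [h0 | h_gt0]; last by apply: coloring_odd => //; lia.
apply: coloring_odd_odd => // [i|]; last by lia.
by move: not_exc; rewrite odd_x h0 /= => /existsP; apply: contra_notT => even_m; exists i.
Qed.

Theorem theorem2p5 (t : nat) (m : nat -> nat) (Sigma x q h R : nat)
  (ht : 3 <= t)
  (hpos : forall i, 1 <= i <= t -> 0 < m i)
  (hmono : forall i j, 1 <= i -> i <= j -> j <= t -> m i <= m j)
  (hSigma : Sigma = \sum_(1 <= i < t.+1) (m i - 1))
  (hx : x = (Sigma + t - 1) %/ (t - 1))
  (hqh : Sigma = q * (t - 1) + h)
  (hh : h <= t - 2)
  (hR : is_chromatic_ramsey (fun i : 'I_(t - 1) => star (m i.+1)) R)
  (hmt : m t <= R - 1) :
  is_chromatic_ramsey (fun i : 'I_t => star (m i.+1))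
    (if [&& odd x, h == 0 & [exists i : 'I_t, ~~ odd (m i.+1)]]
     then x else x + 1).
Proof.
have xE : x = q.+1.
  have -> : x = (q.+1 * (t - 1) + h) %/ (t - 1) by rewrite hx hqh mulSn; congr (_ %/ _); lia.
  by rewrite divnMDl ?divn_small ?addn0; lia.
have sum_m : \sum_(i < t) m i.+1 = t.-1 * x + h.+1.
  have -> : \sum_(i < t) m i.+1 = Sigma + t.
    rewrite hSigma big_add1 /= big_mkord -[t in _ + t]card_ord -sum1_card -big_split /=.
    by apply: eq_bigr => i _; rewrite subnK // hpos //=.
  by rewrite hqh xE mulnS mulnC subn1; lia.
have mt_gt0 : 0 < m t by apply: hpos; lia.
(* K_{R-1} has a good coloring with t - 1 colors, so the counting bound fails. *)
have lt_sum : (t - 1).-1 * m t < \sum_(i < t - 1) m i.+1.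
  have R1_gt0 : 0 < R - 1 by lia.
  have [le_s | lt_s] := leqP (\sum_(i < t - 1) m i.+1 + (R - 1)) ((t - 1) * (R - 1)).
    by have := hR.2 _ (ramsey_star_of_sum R1_gt0 le_s); lia.
  have: (t - 1).-1 * m t <= (t - 1).-1 * (R - 1) by rewrite leq_mul2l hmt orbT.
  have: (t - 1) * (R - 1) = (t - 1).-1 * (R - 1) + (R - 1).
    by rewrite -{1}(@prednK (t - 1)) ?mulSn; lia.
  by lia.
have le_mtx : m t <= x.
  have sum_recr : \sum_(i < t) m i.+1 = \sum_(i < t - 1) m i.+1 + m t.
    rewrite -!(big_mkord xpredT (fun i => m i.+1)).
    by case: (t) ht => // t' _; rewrite subn1 big_nat_recr.
  have t1_gt0 : 0 < t.-1 by lia.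
  rewrite -ltnS -(ltn_pmul2l t1_gt0) mulnS.
  have: t.-1 * m t = (t - 1).-1 * m t + m t by rewrite -{1}(prednK t1_gt0) mulSn subn1 addnC.
  move: lt_sum sum_m; rewrite sum_recr; move: (\sum_(i < t - 1) m i.+1) => S.
  move: (_ * m t) (_ * m t) (_ * x) => A B C; lia.
apply: star_ramsey_number => //; last by lia.
by move=> i; apply: leq_trans le_mtx; apply: hmono.
Qed.
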